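(* Let $V$ be the evaluation function of a weighted separable attribute model with utility function $u$ and weight function $w$, and let $u^{0}(t)=u(t)w(t,0)$ for $t\in\mathbb{R}$. Suppose the model satisfies (Injective): for all real $t>s>0$, $u^{0}(t)\neq u^{0}(s)$; and (Linearity): for all real $t>s>0$, $u^{0}(t-s)=u(t)w(t,s)-u(s)w(s,t)$. If the subject combines the initial endowment and price in a single attribute, then p-MPL accurately elicits quality, that is, for all real $q>0$, $E>0$ and $0<p^{*}<E$, $$V((q,E-p^{*})|\{(q,E-p^{*}),(0,E)\})=V((0,E)|\{(0,E),(q,E-p^{*})\})\quad\text{if and only if}\quad q=p^{*}.$$
   Context: An alternative is a vector $x=(x_{1},\dots,x_{N})\in\mathbb{R}^{N}$ of attribute values. A utility function is a weakly increasing function $u:\mathbb{R}\to\mathbb{R}$ with $u(0)=0$ (and $|u(t)|<\infty$ for all $t\in\mathbb{R}$). A weight function is any function $w:\mathbb{R}\times\mathbb{R}\to\mathbb{R}_{+}=[0,\infty)$ (with $w(t,s)<\infty$ for all $t,s\in\mathbb{R}$). A weighted separable attribute model, given by $u$ and $w$ (the same $u$ and $w$ for all attributes), evaluates an alternative $x$ in a binary menu $\{x,y\}$, where $x,y\in\mathbb{R}^{N}$ satisfy $x_{n}y_{n}\geq 0$ for all $n$, by $$V(x|\{x,y\})=\sum_{n=1}^{N}u(x_{n})\,w(x_{n},y_{n}).$$ In $V(x|\{x,y\})$, $x$ is the evaluated alternative and $y$ the comparison alternative, so $V(y|\{y,x\})=\sum_{n=1}^{N}u(y_{n})\,w(y_{n},x_{n})$.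 In the p-MPL (multiple price list) decision problem a subject endowed with money $E$ chooses between buying a product of subjective quality $q$ at price $p$ and doing nothing. If the subject combines endowment and price in a single attribute, these are represented as $(q,E-p)$ and $(0,E)$ (attributes: quality, earnings). The switch point $p^{*}$ is the price at which the two alternatives have equal evaluation; p-MPL accurately elicits quality when the quality equals the switch point, which is the displayed equivalence. *)

(* Defs.v *)
From mathcomp Require Import all_boot all_order all_algebra.
From mathcomp Require Import reals.

Set Implicit Arguments.
Unset Strict Implicit.
Unset Printing Implicit Defensive.

Import Order.TTheory GRing.Theory Num.Theory.
Local Open Scope ring_scope.

Definition utility_function (R : realType) (u : R -> R) : Prop :=
  {homo u : s t / s <= t} /\ u 0 = 0.

Definition weight_function (R : realType) (w : R -> R -> R) : Prop :=
  forall t s : R, 0 <= w t s.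

(* [wsa_eval u w x y] is V(x|{x,y}): [x] is the evaluated alternative and [y]
   the comparison one. The formula is total; the model gives it meaning only
   on menus satisfying [same_orthant x y]. *)
Definition wsa_eval (R : realType) (u : R -> R) (w : R -> R -> R) (N : nat)
    (x y : 'rV[R]_N) : R :=
  \sum_(n < N) u (x ord0 n) * w (x ord0 n) (y ord0 n).

Definition same_orthant (R : realType) (N : nat) (x y : 'rV[R]_N) : Prop :=
  forall n : 'I_N, 0 <= x ord0 n * y ord0 n.

Definition u0 (R : realType) (u : R -> R) (w : R -> R -> R) (t : R) : R :=
  u t * w t 0.

Definition wsa_injective (R : realType) (u : R -> R) (w : R -> R -> R) : Prop :=
  forall t s : R, 0 < s -> s < t -> u0 u w t <> u0 u w s.

Definition wsa_linear (R : realType) (u : R -> R) (w : R -> R -> R) : Prop :=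
  forall t s : R, 0 < s -> s < t ->
    u0 u w (t - s) = u t * w t s - u s * w s t.

Definition alt2 (R : realType) (a b : R) : 'rV[R]_2 :=
  \row_(i < 2) (if i == ord0 then a else b).

(* Attributes are (quality, earnings): endowment and price are combined in the
   second coordinate. *)
Definition buy (R : realType) (q E p : R) : 'rV[R]_2 := alt2 q (E - p).
Definition no_buy (R : realType) (E : R) : 'rV[R]_2 := alt2 0 E.

Fact buy_same_orthant (R : realType) (q E p : R) :
  0 < E -> p < E -> same_orthant (buy q E p) (no_buy E).
Proof.
move=> E0 pE n; rewrite !mxE; case: ifP => _; first by rewrite mulr0.
by rewrite mulr_ge0 ?subr_ge0 ?ltW.
Qed.

(* Main.v *)
(** By linearity with [t = E] and [s = E - p], the earnings attribute makes
    the two evaluations differ by [u0 p]; as [u 0 = 0], the quality attribute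
    makes them differ by [u0 q]. So they agree iff [u0 q = u0 p], which by
    injectivity means [q = p]. *)
Require Import Defs.
From mathcomp Require Import all_boot all_order all_algebra.
From mathcomp Require Import reals.
Import Order.TTheory GRing.Theory Num.Theory.
Local Open Scope ring_scope.

Lemma wsa_eval_alt2 (R : realType) (u : R -> R) (w : R -> R -> R)
    (a b c d : R) :
  wsa_eval u w (alt2 a b) (alt2 c d) = u a * w a c + u b * w b d.
Proof. by rewrite /wsa_eval big_ord_recl big_ord1 !mxE. Qed.

(** [wsa_injective] speaks only of strictly ordered pairs, so trichotomy is needed to cancel
    [u0]. *)
Lemma u0_inj_pos (R : realType) (u : R -> R) (w : R -> R -> R) (a b : R) :
  wsa_injective u w -> 0 < a -> 0 < b -> u0 u w a = u0 u w b -> a = b.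
Proof.
move=> hinj a_gt0 b_gt0 eq_ab; case: (ltgtP a b) => // [lt_ab | lt_ba].
- by case: (hinj _ _ a_gt0 lt_ab).
- by case: (hinj _ _ b_gt0 lt_ba).
Qed.

Theorem corollary3 (R : realType) (u : R -> R) (w : R -> R -> R)
    (hu : utility_function u) (hw : weight_function w)
    (hinj : wsa_injective u w) (hlin : wsa_linear u w) :
  forall q E p : R, 0 < q -> 0 < E -> 0 < p -> p < E ->
    (wsa_eval u w (buy q E p) (no_buy E) = wsa_eval u w (no_buy E) (buy q E p)
     <-> q = p).
Proof.
move=> q E p q_gt0 _ p_gt0 lt_pE; have [_ u_0] := hu.
have u0pE : u0 u w p = u E * w E (E - p) - u (E - p) * w (E - p) E.
  (* The side conditions [0 < E - p] and [E - p < E] are [p < E] and [0 < p]. *)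
  by rewrite -hlin ?subr_gt0 ?gtrBl // subKr.
(* With [X = u (E - p) * w (E - p) E] and [Y = u E * w E (E - p)], the equality reads
   [u0 u w q + X = Y], while [u0pE] says [u0 u w p = Y - X]. *)
rewrite !wsa_eval_alt2 u_0 mul0r add0r -/(u0 u w q); split=> [eqV | ->].
- by apply: (u0_inj_pos _ _ _ _ _ hinj) => //; rewrite u0pE -eqV addrK.
- by rewrite u0pE subrK.
Qed.
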